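(* Let $(V,|0\rangle,T,Y)$ be a vertex algebra. Then for all homogeneous $a,b,c\in V$, $$\left(a_{(-1)}b\right)_{(-1)}c-a_{(-1)}\left(b_{(-1)}c\right)=\sum_{j\ge0}a_{(-j-2)}\left(b_{(j)}c\right)+p(a,b)\sum_{j\ge0}b_{(-j-2)}\left(a_{(j)}c\right)$$ $$=\left(\int_0^Td\lambda\,a\right)_{(-1)}[b_\lambda c]+p(a,b)\left(\int_0^Td\lambda\,b\right)_{(-1)}[a_\lambda c].$$
   Context: All vector spaces are over $\mathbb{C}$. A superspace is a $\mathbb{Z}_2$-graded space $V=V_{\bar 0}\oplus V_{\bar 1}$; for homogeneous $a,b$ put $p(a,b)=(-1)^{p(a)p(b)}$. An $\mathrm{End}(V)$-valued formal distribution $a(z)=\sum_{n\in\mathbb{Z}}a_{(n)}z^{-n-1}$ (all modes of the same parity) is a field if $a(z)v\in V[[z]][z^{-1}]$ for all $v\in V$. A pair is local if $(z-w)^N[a(z),b(w)]=0$ for some $N\ge0$, where $[a(z),b(w)]=a(z)b(w)-p(a,b)b(w)a(z)$; a local family is a set in which all pairs are local. A vertex algebra $(V,|0\rangle,T,Y)$ consists of a superspace $V$, a vector $|0\rangle\in V_{\bar 0}$, an even endomorphism $T$ of $V$, and a linear parity-preserving map $Y(\cdot,z)$ from $V$ to $\mathrm{End}(V)$-valued fields, $Y(a,z)=\sum_n a_{(n)}z^{-n-1}$, such that: $Y(|0\rangle,z)=\mathrm{Id}_V$, $Y(a,z)|0\rangle\in a+zV[[z]]$, $T|0\rangle=0$;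 $[T,Y(a,z)]=\partial_zY(a,z)$; $\{Y(a,z)\mid a\in V\}$ is a local family. For $a,b\in V$, $a_{(n)}b:=a_{(n)}(b)$; $a_{(-1)}b$ is the normal product. The $\lambda$-bracket on $V$ is $[a_\lambda b]=\sum_{j\ge0}\frac{\lambda^j}{j!}a_{(j)}b$. The integrals are interpreted by expanding the $\lambda$-bracket in powers of $\lambda$, moving the monomials in $\lambda$ to the left under the integral sign, and integrating inside the parentheses: $\left(\int_0^Td\lambda\,a\right)_{(-1)}[b_\lambda c]=\sum_{j\ge0}\left(\int_0^T\frac{\lambda^j}{j!}d\lambda\,a\right)_{(-1)}(b_{(j)}c)=\sum_{j\ge0}\left(\frac{T^{j+1}}{(j+1)!}a\right)_{(-1)}\left(b_{(j)}c\right)$. *)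

(* Defs.v *)
From mathcomp Require Import all_boot all_order all_algebra.
From mathcomp Require Import all_classical reals.
From mathcomp Require Import complex.

Set Implicit Arguments.
Unset Strict Implicit.
Unset Printing Implicit Defensive.

Import Order.TTheory GRing.Theory Num.Theory.
Local Open Scope classical_set_scope.
Local Open Scope ring_scope.

(* Parities are booleans: [false] is even, [true] is odd; the sum of parities
   is [addb] and their product is [andb]. *)
Record superspace (R : realType) := Superspace {
  sspace :> lmodType R[i];
  homog : bool -> set sspace;
  homog0 : forall p, homog p 0;
  homog_linear : forall p k u v,
    homog p u -> homog p v -> homog p (k *: u + v);
  homog_span : forall v, exists u0 u1,
    [/\ homog false u0, homog true u1 & v = u0 + u1];
  homog_direct : forall v, homog false v -> homog true v -> v = 0
}.

Section FormalDistributions.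
Variables (R : realType) (V : superspace R).

Definition has_parity (p : bool) (f : V -> V) : Prop :=
  forall q v, homog q v -> homog (p (+) q) (f v).

(* [a n] is the mode a_(n), that is, the coefficient of z^(-n-1). *)
Definition distr := int -> {linear V -> V}.

(* a(z)v has finitely many negative powers of z for every v *)
Definition is_field (a : distr) : Prop :=
  forall v, exists N : int, forall n, N <= n -> a n v = 0.

(* [f m n] is the coefficient of z^(-m-1) w^(-n-1). *)
Definition distr2 := int -> int -> V -> V.

Definition mul_zw (f : distr2) : distr2 :=
  fun m n v => f (m + 1) n v - f m (n + 1) v.

(* The coefficients of [a(z), b(w)] for a(z) of parity p and b(w) of
   parity q. *)
Definition sbracket (p q : bool) (a b : distr) : distr2 :=
  fun m n v => a m (b n v) - (-1) ^+ (p && q) *: b n (a m v).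

Definition local_pair (p q : bool) (a b : distr) : Prop :=
  exists N : nat, forall m n v, iter N mul_zw (sbracket p q a b) m n v = 0.

End FormalDistributions.

(* The supercommutator is defined on homogeneous fields and extended
   bilinearly; as a finite sum of local brackets is local, locality of
   {Y(a,z)} is the locality of the pairs with a and b homogeneous. *)
Record vertex_algebra (R : realType) := VertexAlgebra {
  va_space :> superspace R;
  vac : va_space;
  T : {linear va_space -> va_space};
  Y : va_space -> distr va_space;
  vac_even : homog false vac;
  T_even : has_parity false T;
  Y_linear : forall k a b n v, Y (k *: a + b) n v = k *: Y a n v + Y b n v;
  Y_parity : forall p a n, homog p a -> has_parity p (Y a n);
  Y_field : forall a, is_field (Y a);
  Y_vac : forall n v, Y vac n v = if n == -1 then v else 0;
  Y_create : forall a, Y a (-1) vac = a;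
  Y_create0 : forall a n, 0 <= n -> Y a n vac = 0;
  T_vac : T vac = 0;
  (* The coefficient of z^(-n-1) in the z-derivative of
     \sum_n a_(n) z^(-n-1) is - n a_(n-1). *)
  T_cov : forall a n v, T (Y a n v) - Y a n (T v) = - (n%:~R *: Y a (n - 1) v);
  Y_local : forall p q a b,
    homog p a -> homog q b -> local_pair p q (Y a) (Y b)
}.

Arguments vac {R V} : rename.
Arguments T {R V} : rename.
Arguments Y {R V} : rename.

Section LambdaBracket.
Variables (R : realType) (V : vertex_algebra R).

Definition nprod (a b : V) : V := Y a (-1) b.

(* Elements of V[lambda] are given by their coefficients:
   [lbracket a b j] is the coefficient of lambda^j. *)
Definition lbracket (a b : V) : nat -> V :=
  fun j => (j`!%:R)^-1 *: Y a j%:Z b.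

(* \int_0^T q(lambda) d lambda, applied to a *)
Definition int0T (q : {poly R[i]}) (a : V) : V :=
  \sum_(i < size q) (q`_i / i.+1%:R) *: iter i.+1 T a.

(* (\int_0^T d lambda a)_(-1) P(lambda), for P in V[lambda]. The sum
   over [set: nat] is meaningful because P has finitely many nonzero
   coefficients. *)
Definition nprod_int (a : V) (P : nat -> V) : V :=
  \sum_(j \in [set: nat]) nprod (int0T 'X^j a) (P j).

Lemma nprod_int_lbracketE a b c :
  nprod_int a (lbracket b c) =
  \sum_(j \in [set: nat])
    nprod ((j.+1`!%:R)^-1 *: iter j.+1 T a) (Y b j%:Z c).
Proof.
have YZ k u n v : Y (k *: u) n v = k *: Y u n v :> V.
  have Y0 : Y (0 : V) n v = 0.
    by have := Y_linear 1 (0 : V) 0 n v;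
       rewrite !scale1r addr0 => /eqP; rewrite -subr_eq0 opprD addNKr oppr_eq0 => /eqP.
  by rewrite -[k *: u]addr0 Y_linear Y0 addr0.
apply: eq_fsbigr => j _; rewrite /nprod /lbracket /int0T.
rewrite size_polyXn big_ord_recr /= big1 ?add0r => [|i _]; last first.
  by rewrite coefXn ltn_eqF // mul0r scale0r.
rewrite coefXn eqxx mul1r linearZ /= !YZ scalerA; congr (_ *: _).
by rewrite factS natrM invfM mulrC.
Qed.

Lemma finite_modes (F : nat -> V -> V) (b c : V) :
  (forall j, F j 0 = 0) ->
  finite_set ([set: nat] `&` (fun j : nat => F j (Y b j%:Z c)) @^-1` [set~ 0]).
Proof.
move=> F0; have [N HN] := Y_field b c.
apply: (@sub_finite_set _ _ `I_(`|N|%N)); last exact: finite_II.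
move=> j /= [_]; apply: contra_notP => /negP; rewrite -leqNgt => Nj.
rewrite HN ?F0 //; apply: le_trans (ler_norm N) _.
by rewrite -abszE lez_nat.
Qed.

End LambdaBracket.

(* Main.v *)
From HB Require Import structures.
Require Import Defs.
From mathcomp Require Import all_boot all_order all_algebra.
From mathcomp Require Import all_classical reals.
From mathcomp Require Import complex.
From mathcomp Require Import zify.

(** The identity is a comparison of coefficients in the equality of fields
      Y(a_(-1)b, z) = :Y(a,z)Y(b,z):
    where :a(z)b(z): = a(z)_+ b(z) + p(a,b) b(z) a(z)_- is the normally
    ordered product. Its coefficient of z^0 applied to c is
      sum_(j >= 0) a_(-1-j) (b_(-1+j) c)
        + p(a,b) sum_(j >= 0) b_(-2-j) (a_(j) c),
    and the term j = 0 of the first sum is a_(-1)(b_(-1)c); the other terms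
    are the two sums of the statement.

    The equality of fields ([Y_nprod]) is a case of Goddard's uniqueness
    principle ([vac_local_unique]): two fields with the same value on the
    vacuum, both local with Y(c,z), agree on c. Equality on the vacuum
    ([normal_mode_vac]) holds because both sides satisfy the recursion
    T x_n = - n x_(n-1), whose solutions are determined by their terms of
    index n >= -1 ([translation_unique]). Locality of the normally ordered
    product with Y(c,z) is Dong's lemma ([normal_mode_local]): with x, z, w the
    variables of a, b, c, the product is the residue in x of
      a(x)b(z) / (x-z) - p(a,b) b(z)a(x) / (x-z),
    the two quotients being expanded in |x| > |z| and in |x| < |z|. Its
    supercommutator H with c(w), before the residue is taken, is annihilated
    by a power of x-z and, after multiplication by a power of z-w, by a power
    of x-w. As z-w = (x-w) - (x-z), a power of z-w annihilates H
    ([iter_diff_triangle]).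

    The integral form follows from Y(Ta, z) = dY(a, z)/dz ([Y_T_homog]), again
    by uniqueness: iterating it turns T^(j+1) a / (j+1)! in the mode -1 into
    the mode -j-2 of a.

    Formal distributions in several variables are functions from an abelian
    group of exponents to V. Multiplication by a variable is a translation, so
    x-z, x-w and z-w become commuting difference operators. *)

Set Implicit Arguments.
Unset Strict Implicit.
Unset Printing Implicit Defensive.

Import Order.TTheory GRing.Theory Num.Theory.
Local Open Scope classical_set_scope.
Local Open Scope ring_scope.

(** * Eventually zero sums over the natural numbers *)

Definition ev_zero (U : zmodType) (F : nat -> U) : Prop :=
  exists M, forall j, (M <= j)%N -> F j = 0.

Lemma fsumE (U : zmodType) (F : nat -> U) (M : nat) :
  (forall j, (M <= j)%N -> F j = 0) ->
  \sum_(j \in [set: nat]) F j = \sum_(j < M) F j.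
Proof.
move=> FM; rewrite fsbig_ord; apply/esym/fsbig_widen => // j /= [_] /negP.
by rewrite -leqNgt => /FM.
Qed.

Lemma fsum_recl (U : zmodType) (F : nat -> U) : ev_zero F ->
  \sum_(j \in [set: nat]) F j = F 0%N + \sum_(j \in [set: nat]) F j.+1.
Proof.
move=> [M FM]; rewrite (@fsumE _ _ M.+1) => [|j /ltnW/FM//].
by rewrite big_ord_recl (@fsumE _ _ M) // => j Mj; apply: FM; apply: leqW.
Qed.

Lemma fsum_linear (K : nzRingType) (U : lmodType K) (k : K) (F G : nat -> U) :
  ev_zero F -> ev_zero G ->
  \sum_(j \in [set: nat]) (k *: F j + G j) =
  k *: (\sum_(j \in [set: nat]) F j) + \sum_(j \in [set: nat]) G j.
Proof.
move=> [M FM] [N GN].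
have FMN j : (maxn M N <= j)%N -> F j = 0 by rewrite geq_max => /andP[/FM].
have GMN j : (maxn M N <= j)%N -> G j = 0 by rewrite geq_max => /andP[_ /GN].
rewrite (fsumE FMN) (fsumE GMN) (@fsumE _ _ (maxn M N)); last first.
  by move=> j Mj; rewrite FMN // GMN // scaler0 addr0.
by rewrite big_split /= scaler_sumr.
Qed.

Lemma raddf_fsum (U W : zmodType) (phi : {additive U -> W}) (F : nat -> U) :
  ev_zero F ->
  phi (\sum_(j \in [set: nat]) F j) = \sum_(j \in [set: nat]) phi (F j).
Proof.
move=> [M FM]; rewrite (fsumE FM) raddf_sum (@fsumE _ _ M) // => j /FM ->.
exact: raddf0.
Qed.

(** * Difference operators and geometric expansions *)

Section Difference.
Context {K : nzRingType} {A : zmodType} {U : lmodType K}.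
Implicit Types (s t u v p : A) (F G : A -> U).

(** For a distribution stored as the function of its exponents, this is
    multiplication by the difference of the two variables whose translations
    are [s] and [t]. *)
Definition diff s t F : A -> U := fun p => F (p + s) - F (p + t).

Lemma diff_linear s t k F G :
  diff s t (k *: F + G) = k *: diff s t F + diff s t G.
Proof.
apply/funext => p; rewrite /diff !fctE scalerBr opprD !addrA.
by congr (_ - _); rewrite addrAC.
Qed.

Lemma iter_diff_linear n s t k F G :
  iter n (diff s t) (k *: F + G) =
  k *: iter n (diff s t) F + iter n (diff s t) G.
Proof. by elim: n => //= n ->; rewrite diff_linear. Qed.

Lemma iter_diff0 n s t : iter n (diff s t) (0 : A -> U) = 0.
Proof. by elim: n => //= n ->; apply/funext => p; exact: subrr. Qed.

Lemma diffC s t u v F :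
  diff s t (diff u v F) = diff u v (diff s t F).
Proof.
apply/funext => p; rewrite /diff !(addrAC p u) !(addrAC p v).
by rewrite !opprB addrACA [RHS]addrACA [- F _ - F _]addrC.
Qed.

Lemma iter_diffC n s t u v F :
  iter n (diff s t) (diff u v F) = diff u v (iter n (diff s t) F).
Proof. by elim: n => //= n ->; rewrite diffC. Qed.

Lemma iter_diff_iterC m n s t u v F :
  iter m (diff s t) (iter n (diff u v) F) =
  iter n (diff u v) (iter m (diff s t) F).
Proof. by elim: n => //= n <-; rewrite iter_diffC. Qed.

Lemma diff_triangle s t u F :
  diff t u F = (-1) *: diff s t F + diff s u F.
Proof.
apply/funext => p; rewrite /diff !fctE scaleN1r opprB.
by rewrite addrA subrK.
Qed.

(** The heart of Dong's lemma. By [diff_triangle] a factor t-u is the difference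
    of a factor s-u and a factor s-t, and either one lowers one of the two
    exponents; so induction on the sum of the exponents applies. *)
Lemma iter_diff_triangle i j s t u F :
  iter i (diff s t) F = 0 -> iter j (diff s u) F = 0 ->
  iter (i + j) (diff t u) F = 0.
Proof.
have [n ijn] := ubnP (i + j)%N.
elim: n => // n IH in i j F ijn *.
case: i ijn => [|i] ijn; first by move=> /= -> _; exact: iter_diff0.
case: j ijn => [|j] ijn; first by move=> _ F0; rewrite [F]F0; exact: iter_diff0.
move=> Fi Fj; rewrite addnS iterSr (diff_triangle s) iter_diff_linear.
have -> : iter (i.+1 + j) (diff t u) (diff s t F) = 0.
  rewrite addSnnS; apply: IH; first by lia.
  - by rewrite -iterSr.
  - by rewrite iter_diffC Fj; exact: (iter_diff0 1).
rewrite scaler0 add0r; apply: IH; first by lia.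
- by rewrite iter_diffC Fi; exact: (iter_diff0 1).
- by rewrite -iterSr.
Qed.

Definition summable s t F : Prop :=
  forall p, ev_zero (fun j => F (p + (t - s) *+ j)).

(** Multiplication by the expansion of 1/(s-t) in the domain |s| > |t|, namely
    sum_j s^(-1-j) t^j. Exchanging [s] and [t] gives, up to sign, the other
    expansion. *)
Definition geom s t F : A -> U :=
  fun p => \sum_(j \in [set: nat]) F (p - s + (t - s) *+ j).

Lemma summable_linear s t k F G :
  summable s t F -> summable s t G -> summable s t (k *: F + G).
Proof.
move=> sF sG p; have [[M FM] [N GN]] := (sF p, sG p).
exists (maxn M N) => j; rewrite geq_max !fctE => /andP[/FM -> /GN ->].
by rewrite scaler0 addr0.
Qed.

Lemma summable_shift s t u F :
  summable s t F -> summable s t (fun p => F (p + u)).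
Proof.
by move=> sF p; have [M FM] := sF (p + u); exists M => j /FM; rewrite addrAC.
Qed.

Lemma diffE s t F :
  diff s t F = (-1) *: (fun p => F (p + t)) + (fun p => F (p + s)).
Proof. by apply/funext => p; rewrite /diff !fctE scaleN1r addrC. Qed.

Lemma summable_diff s t u v F : summable s t F -> summable s t (diff u v F).
Proof.
by move=> sF; rewrite diffE; apply: summable_linear; apply: summable_shift.
Qed.

Lemma summable_iter_diff n s t u v F :
  summable s t F -> summable s t (iter n (diff u v) F).
Proof. by move=> sF; elim: n => //= n; exact: summable_diff. Qed.

Lemma geom_linear s t k F G : summable s t F -> summable s t G ->
  geom s t (k *: F + G) = k *: geom s t F + geom s t G.
Proof. by move=> sF sG; apply/funext => p; apply: fsum_linear. Qed.

Lemma geom0 s t : geom s t (0 : A -> U) = 0.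
Proof. by apply/funext => p; rewrite /geom (@fsumE _ _ 0) ?big_ord0. Qed.

Lemma geom_iter_diff n s t u v F : summable s t F ->
  geom s t (iter n (diff u v) F) = iter n (diff u v) (geom s t F).
Proof.
move=> sF; elim: n => //= n <-; rewrite diffE geom_linear; first last.
- exact/summable_shift/summable_iter_diff.
- exact/summable_shift/summable_iter_diff.
rewrite diffE; congr (_ *: _ + _); apply/funext => p;
  apply: eq_fsbigr => j _; congr (iter _ _ _ _);
  by rewrite addrAC [p - s + _]addrAC.
Qed.

(** The sum telescopes: both terms of the difference are the same series, up to
    a shift of the index that drops its first term. *)
Lemma diff_geom s t F : summable s t F -> diff s t (geom s t F) = F.
Proof.
move=> sF; apply/funext => p; rewrite /diff /geom addrK fsum_recl //.
rewrite mulr0n addr0 -addrA -[RHS]addr0; congr (_ + _); apply/eqP.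
rewrite subr_eq0; apply/eqP; apply: eq_fsbigr => j _.
by rewrite mulrS !addrA.
Qed.

End Difference.

(** * Modes as exponents *)

Definition idx3 := (int * int * int)%type.
HB.instance Definition _ := GRing.Zmodule.on idx3.

Definition e1 : idx3 := (1, 0, 0).
Definition e2 : idx3 := (0, 1, 0).
Definition e3 : idx3 := (0, 0, 1).

Lemma pair_mulrn (A B : zmodType) (x : A) (y : B) n :
  (x, y) *+ n = (x *+ n, y *+ n).
Proof. by elim: n => // n IH; rewrite !mulrS IH. Qed.

Lemma idx3_addE (p q : idx3) :
  p + q = (p.1.1 + q.1.1, p.1.2 + q.1.2, p.2 + q.2).
Proof. by []. Qed.

Lemma e1_mulrn n : e1 *+ n = (n%:Z, 0, 0).
Proof. by rewrite /e1 !pair_mulrn !mul0rn natz. Qed.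

Lemma e2_mulrn n : e2 *+ n = (0, n%:Z, 0).
Proof. by rewrite /e2 !pair_mulrn !mul0rn natz. Qed.

Lemma e3_mulrn n : e3 *+ n = (0, 0, n%:Z).
Proof. by rewrite /e3 !pair_mulrn !mul0rn natz. Qed.

Lemma e2Be1_mulrn n : (e2 - e1) *+ n = (- n%:Z, n%:Z, 0).
Proof.
rewrite mulrnBl e1_mulrn e2_mulrn; congr (_, _, _); rewrite /=; lia.
Qed.

Lemma e1Be2_mulrn n : (e1 - e2) *+ n = (n%:Z, - n%:Z, 0).
Proof.
rewrite mulrnBl e1_mulrn e2_mulrn; congr (_, _, _); rewrite /=; lia.
Qed.

(** Transfers locality to difference operators on any exponent group. The map
    [phi] stands for the modes applied after the supercommutator (or the
    identity), the vector [v] for the result of those applied before it. *)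
Lemma iter_diff_mul_zw (R : realType) (V : superspace R) (A : zmodType)
    (U : lmodType R[i]) (phi : {additive V -> U}) (f : distr2 V) (v : V)
    (s t : A) (F : A -> U) N p m n :
  (forall i j : nat,
     F (p + s *+ i + t *+ j) = phi (f (m + i%:Z) (n + j%:Z) v)) ->
  iter N (diff s t) F p = phi (iter N (@mul_zw R V) f m n v).
Proof.
elim: N p m n => [|N IH] p m n Ff.
  by have := Ff 0 0; rewrite !mulr0n !addr0.
rewrite !iterS {1}/diff {1}/mul_zw raddfB; congr (_ - _); apply: IH => i j.
  by have := Ff i.+1 j; rewrite mulrS -!addrA intS.
have := Ff i j.+1; rewrite mulrS intS [n + _]addrA => <-.
by rewrite -!addrA [t + (_ + _)]addrCA.
Qed.

(** * Normally ordered products and Dong's lemma *)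

Section VertexAlgebra.
Context {R : realType} {V : vertex_algebra R}.
Implicit Types (a b c v : V) (pa pb pc : bool).

Lemma modeD a n u v : Y a n (u + v) = Y a n u + Y a n v.
Proof. exact: linearD. Qed.

Lemma modeZ a n (k : R[i]) v : Y a n (k *: v) = k *: Y a n v.
Proof. exact: linearZ_LR. Qed.

Lemma mode0 a n : Y a n 0 = 0.
Proof. exact: linear0. Qed.

Lemma modeB a n u v : Y a n (u - v) = Y a n u - Y a n v.
Proof. exact: linearB. Qed.

Lemma Y_scale (k : R[i]) a n v : Y (k *: a) n v = k *: Y a n v.
Proof.
have Y0 : Y (0 : V) n v = 0.
  have := Y_linear 1 (0 : V) 0 n v.
  by rewrite !scale1r addr0 -[LHS]addr0 => /addrI/esym.
by rewrite -[k *: a]addr0 Y_linear Y0 addr0.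
Qed.

Lemma Y_ev_zero b (n : int) v : ev_zero (fun j : nat => Y b (n + j%:Z) v).
Proof.
by have [N HN] := Y_field b v; exists `|N - n|%N => j Mj; apply: HN; lia.
Qed.

(** The coefficient of z^(-n-1) in :Y(a,z)Y(b,z):. *)
Definition normal_mode pa pb a b (n : int) v : V :=
  \sum_(j \in [set: nat]) Y a (- 1 - j%:Z) (Y b (n + j%:Z) v) +
  (-1) ^+ (pa && pb) *:
    \sum_(j \in [set: nat]) Y b (n - 1 - j%:Z) (Y a j%:Z v).

(** Dong's lemma for the normally ordered product. The coordinates of [idx3]
    are the modes of a, b and c, so [e1], [e2], [e3] multiply by the variables
    x, z, w; the mode 0 of a selects the residue in x. *)
Lemma normal_mode_local pa pb pc a b c :
  homog pa a -> homog pb b -> homog pc c ->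
  exists N : nat, forall m n v,
    iter N (@mul_zw R V)
      (fun m n v => normal_mode pa pb a b m (Y c n v) -
         (-1) ^+ ((pa (+) pb) && pc) *: Y c n (normal_mode pa pb a b m v))
      m n v = 0.
Proof.
move=> ha hb hc.
have [Nab Lab] := Y_local ha hb.
have [Nac Lac] := Y_local ha hc.
have [Nbc Lbc] := Y_local hb hc.
exists (Nab.+1 + Nac + Nbc)%N => m n v.
set eps := (-1) ^+ (pa && pb) : R[i].
have -> : (-1) ^+ ((pa (+) pb) && pc) =
          (-1) ^+ (pa && pc) * (-1) ^+ (pb && pc) :> R[i].
  by rewrite andb_addl signr_addb.
set eac := (-1) ^+ (pa && pc); set ebc := (-1) ^+ (pb && pc).
(* An opaque sign, so that rewriting does not see the product. *)
have [eta etaE] : exists eta, eta = eac * ebc by exists (eac * ebc).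
rewrite -etaE.
(* The four orderings met in the supercommutator of the product with c(w):
   F collects those with a to the left of b, G those with b to the left of a,
   and the residue of H in x is the supercommutator. *)
pose abc (p : idx3) := Y a p.1.1 (Y b p.1.2 (Y c p.2 v)) : V.
pose bac (p : idx3) := Y b p.1.2 (Y a p.1.1 (Y c p.2 v)) : V.
pose cab (p : idx3) := Y c p.2 (Y a p.1.1 (Y b p.1.2 v)) : V.
pose cba (p : idx3) := Y c p.2 (Y b p.1.2 (Y a p.1.1 v)) : V.
pose F := - eta *: cab + abc.
pose G := - eta *: cba + bac.
pose H := eps *: geom e2 e1 G + geom e1 e2 F.
have sab : summable e1 e2 abc.
  move=> p; have [M HM] := Y_ev_zero b p.1.2 (Y c p.2 v).
  exists M => j /HM E; rewrite /abc idx3_addE e2Be1_mulrn /= addr0 E.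
  exact: mode0.
have sba : summable e2 e1 bac.
  move=> p; have [M HM] := Y_ev_zero a p.1.1 (Y c p.2 v).
  exists M => j /HM E; rewrite /bac idx3_addE e1Be2_mulrn /= addr0 E.
  exact: mode0.
have scab : summable e1 e2 cab.
  move=> p; have [M HM] := Y_ev_zero b p.1.2 v.
  exists M => j /HM E; rewrite /cab idx3_addE e2Be1_mulrn /= E.
  by rewrite !mode0.
have scba : summable e2 e1 cba.
  move=> p; have [M HM] := Y_ev_zero a p.1.1 v.
  exists M => j /HM E; rewrite /cba idx3_addE e1Be2_mulrn /= E.
  by rewrite !mode0.
have sF : summable e1 e2 F by exact: summable_linear.
have sG : summable e2 e1 G by exact: summable_linear.
(* Multiplication by x-z clears both denominators and leaves the
   supercommutator of a and b, with c to its right or to its left. *)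
have Hab : iter Nab.+1 (diff e1 e2) H = 0.
  rewrite iterSr.
  pose X (p : idx3) :=
    sbracket pa pb (Y a) (Y b) p.1.1 p.1.2 (Y c p.2 v) : V.
  pose X' (p : idx3) :=
    Y c p.2 (sbracket pa pb (Y a) (Y b) p.1.1 p.1.2 v) : V.
  have -> : diff e1 e2 H = - eta *: X' + X.
    rewrite /H diff_linear diff_geom //.
    have -> : diff e1 e2 (geom e2 e1 G) = - G.
      rewrite -[in RHS](diff_geom sG); apply/funext => p.
      by rewrite /diff /= opprB.
    apply/funext => p; rewrite /X /X' /sbracket !fctE.
    rewrite modeB modeZ -/eps.
    rewrite [in RHS]scalerBr [RHS]addrACA -opprD scalerA mulrC -scalerA.
    by rewrite -scalerDr -scalerN [RHS]addrC.
  rewrite iter_diff_linear.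
  have -> : iter Nab (diff e1 e2) X = 0.
    apply/funext => p.
    rewrite (@iter_diff_mul_zw _ V _ _ idfun (sbracket pa pb (Y a) (Y b))
      (Y c p.2 v) _ _ _ _ _ p.1.1 p.1.2) => [|i j]; first exact: Lab.
    by rewrite e1_mulrn e2_mulrn /X !idx3_addE /= !addr0.
  have -> : iter Nab (diff e1 e2) X' = 0.
    apply/funext => p.
    rewrite (@iter_diff_mul_zw _ V _ _ (Y c p.2) (sbracket pa pb (Y a) (Y b))
      v _ _ _ _ _ p.1.1 p.1.2) => [|i j]; first by rewrite Lab; exact: mode0.
    by rewrite e1_mulrn e2_mulrn /X' !idx3_addE /= !addr0.
  by rewrite scaler0 addr0.
(* Moving c from the right of a and b to their left takes two exchanges, one
   costing a power of z-w and the other a power of x-w. *)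
have Fc : iter Nac (diff e1 e3) (iter Nbc (diff e2 e3) F) = 0.
  pose X (p : idx3) :=
    sbracket pa pc (Y a) (Y c) p.1.1 p.2 (Y b p.1.2 v) : V.
  pose X' (p : idx3) :=
    Y a p.1.1 (sbracket pb pc (Y b) (Y c) p.1.2 p.2 v) : V.
  have -> : F = ebc *: X + X'.
    apply/funext => p; rewrite /F /X /X' /sbracket !fctE.
    rewrite modeB modeZ -/eac -/ebc etaE scalerBr scalerA.
    by rewrite [RHS]addrC addrA subrK /abc /cab scaleNr [ebc * _]mulrC addrC.
  rewrite !iter_diff_linear.
  have -> : iter Nbc (diff e2 e3) X' = 0.
    apply/funext => p.
    rewrite (@iter_diff_mul_zw _ V _ _ (Y a p.1.1) (sbracket pb pc (Y b) (Y c))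
      v _ _ _ _ _ p.1.2 p.2) => [|i j]; first by rewrite Lbc; exact: mode0.
    by rewrite e2_mulrn e3_mulrn /X' !idx3_addE /= !addr0.
  rewrite iter_diff_iterC.
  have -> : iter Nac (diff e1 e3) X = 0.
    apply/funext => p.
    rewrite (@iter_diff_mul_zw _ V _ _ idfun (sbracket pa pc (Y a) (Y c))
      (Y b p.1.2 v) _ _ _ _ _ p.1.1 p.2) => [|i j]; first exact: Lac.
    by rewrite e1_mulrn e3_mulrn /X !idx3_addE /= !addr0.
  by rewrite !iter_diff0 scaler0 addr0.
have Gc : iter Nac (diff e1 e3) (iter Nbc (diff e2 e3) G) = 0.
  pose X (p : idx3) :=
    sbracket pb pc (Y b) (Y c) p.1.2 p.2 (Y a p.1.1 v) : V.
  pose X' (p : idx3) :=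
    Y b p.1.2 (sbracket pa pc (Y a) (Y c) p.1.1 p.2 v) : V.
  have -> : G = eac *: X + X'.
    apply/funext => p; rewrite /G /X /X' /sbracket !fctE.
    rewrite modeB modeZ -/eac -/ebc etaE scalerBr scalerA.
    by rewrite [RHS]addrC addrA subrK /bac /cba scaleNr addrC.
  rewrite !iter_diff_linear.
  have -> : iter Nbc (diff e2 e3) X = 0.
    apply/funext => p.
    rewrite (@iter_diff_mul_zw _ V _ _ idfun (sbracket pb pc (Y b) (Y c))
      (Y a p.1.1 v) _ _ _ _ _ p.1.2 p.2) => [|i j]; first exact: Lbc.
    by rewrite e2_mulrn e3_mulrn /X !idx3_addE /= !addr0.
  rewrite [X in _ + X]iter_diff_iterC.
  have -> : iter Nac (diff e1 e3) X' = 0.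
    apply/funext => p.
    rewrite (@iter_diff_mul_zw _ V _ _ (Y b p.1.2) (sbracket pa pc (Y a) (Y c))
      v _ _ _ _ _ p.1.1 p.2) => [|i j]; first by rewrite Lac; exact: mode0.
    by rewrite e1_mulrn e3_mulrn /X' !idx3_addE /= !addr0.
  by rewrite !iter_diff0 scaler0 addr0.
have Hc : iter Nac (diff e1 e3) (iter Nbc (diff e2 e3) H) = 0.
  rewrite !iter_diff_linear -!geom_iter_diff //;
    try exact: summable_iter_diff.
  by rewrite Fc Gc !geom0 scaler0 addr0.
have H0 : iter (Nab.+1 + Nac + Nbc) (diff e2 e3) H (0, m, n) = 0.
  rewrite iterD; set H' := iter Nbc _ H in Hc *.
  rewrite (@iter_diff_triangle _ _ _ _ _ e1) //.
  by rewrite /H' iter_diff_iterC Hab iter_diff0.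
rewrite -[RHS]H0; apply/esym.
apply: (@iter_diff_mul_zw _ V _ _ idfun) => i j /=.
rewrite e2_mulrn e3_mulrn !idx3_addE /= !addr0.
move: (m + i) (n + j) => {H0 i j}m {}n.
have E12 (j : nat) : (0, m, n) - e1 + (e2 - e1) *+ j =
    (- 1 - j%:Z, m + j%:Z, n) :> idx3.
  by rewrite e2Be1_mulrn !idx3_addE; congr (_, _, _); rewrite /=; lia.
have E21 (j : nat) : (0, m, n) - e2 + (e1 - e2) *+ j =
    (j%:Z, m - 1 - j%:Z, n) :> idx3.
  by rewrite e1Be2_mulrn !idx3_addE; congr (_, _, _); rewrite /=; lia.
have -> : H (0, m, n) = eps *: (- eta *: geom e2 e1 cba (0, m, n) +
      geom e2 e1 bac (0, m, n)) +
    (- eta *: geom e1 e2 cab (0, m, n) + geom e1 e2 abc (0, m, n)).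
  by rewrite /H /F /G !geom_linear.
have gab u : ev_zero (fun j : nat => Y a (- 1 - j%:Z) (Y b (m + j%:Z) u)).
  by have [M HM] := Y_ev_zero b m u; exists M => j /HM ->; rewrite mode0.
have gba u : ev_zero (fun j : nat => Y b (m - 1 - j%:Z) (Y a j%:Z u)).
  have [M HM] := Y_ev_zero a 0 u; exists M => j /HM; rewrite add0r => ->.
  exact: mode0.
have -> : geom e1 e2 abc (0, m, n) =
    \sum_(j \in [set: nat]) Y a (- 1 - j%:Z) (Y b (m + j%:Z) (Y c n v)).
  by apply: eq_fsbigr => j _; rewrite E12.
have -> : geom e2 e1 bac (0, m, n) =
    \sum_(j \in [set: nat]) Y b (m - 1 - j%:Z) (Y a j%:Z (Y c n v)).
  by apply: eq_fsbigr => j _; rewrite E21.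
have -> : geom e1 e2 cab (0, m, n) =
    Y c n (\sum_(j \in [set: nat]) Y a (- 1 - j%:Z) (Y b (m + j%:Z) v)).
  rewrite (raddf_fsum (Y c n) (gab v)).
  by apply: eq_fsbigr => j _; rewrite E12.
have -> : geom e2 e1 cba (0, m, n) =
    Y c n (\sum_(j \in [set: nat]) Y b (m - 1 - j%:Z) (Y a j%:Z v)).
  rewrite (raddf_fsum (Y c n) (gba v)).
  by apply: eq_fsbigr => j _; rewrite E21.
rewrite /normal_mode -/eps modeD modeZ -scaleNr !scalerDr !scalerA.
by rewrite [LHS]addrC [LHS]addrACA [LHS]addrC [eps * _]mulrC.
Qed.

(** * Uniqueness of fields with given values on the vacuum *)

Definition d1 : int * int := (1, 0).
Definition d2 : int * int := (0, 1).

Lemma iter_mul_zwE N (f : distr2 V) v (m n : int) :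
  iter N (@mul_zw R V) f m n v =
  iter N (diff d1 d2) (fun p => f p.1 p.2 v) (m, n).
Proof.
apply/esym; apply: (@iter_diff_mul_zw _ V _ _ idfun) => i j.
by rewrite /d1 /d2 !pair_mulrn !mul0rn !natz /= !addr0.
Qed.

(** Both recursions give n f(n-1) = n g(n-1) once f(n) = g(n), and n is nonzero
    for n <= -1, so equality propagates downwards from n = -1. *)
Lemma translation_unique (f g : int -> V) :
  (forall n : int, -1 <= n -> f n = g n) ->
  (forall n : int, T (f n) = - (n%:~R *: f (n - 1))) ->
  (forall n : int, T (g n) = - (n%:~R *: g (n - 1))) ->
  f =1 g.
Proof.
move=> fg Tf Tg.
have fgN (k : nat) : f (- 1 - k%:Z) = g (- 1 - k%:Z).
  elim: k => [|k IH]; first by rewrite fg.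
  have := Tf (- 1 - k%:Z); rewrite IH Tg => /oppr_inj /eqP.
  rewrite -subr_eq0 -scalerBr scaler_eq0 => /orP[|].
    by rewrite intr_eq0; lia.
  rewrite subr_eq0 => /eqP/esym.
  by congr (f _ = g _); lia.
move=> n; have [/fg //|n1] := lerP (-1) n.
by have := fgN (absz (- 1 - n)%R); congr (f _ = g _); lia.
Qed.

(** The coefficients of (D(z) Y(c,w) - k Y(c,w) D(z)) |0>. Evaluation on the
    vacuum is all that the uniqueness principle uses; [k] is the sign of the
    supercommutator. *)
Definition vac_bracket (k : R[i]) (D : int -> V -> V) c (p : int * int) : V :=
  D p.1 (Y c p.2 vac) - k *: Y c p.2 (D p.1 vac).

Definition vac_local k D c : Prop :=
  exists N, iter N (diff d1 d2) (vac_bracket k D c) = 0.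

(** If F(z,w) has only nonnegative powers of w, multiplication by (z-w)^N acts
    on its w^0 coefficient as multiplication by z^N. *)
Lemma iter_diff_boundary N (F : int * int -> V) (m n : int) :
  (forall p, 0 <= p.2 -> F p = 0) -> -1 <= n ->
  iter N (diff d1 d2) F (m, n) = F (m + N%:Z, n).
Proof.
move=> F0; elim: N m n => [|N IH] m n n1; first by rewrite addr0.
rewrite iterS /diff /= IH ?addr0 // [X in _ - X]IH; last by rewrite /=; lia.
rewrite [X in _ - X]F0 ?subr0 /=; last by lia.
by rewrite -addrA intS.
Qed.

(** Goddard's uniqueness principle. The difference E of the two fields kills the
    vacuum, so locality gives (z-w)^N E(z) Y(c,w)|0> = 0; here Y(c,w)|0> has no
    negative power of w and constant term c, and w = 0 leaves z^N E(z)c = 0. *)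
Lemma vac_local_unique k (D D' : int -> V -> V) c :
  (forall n, D n 0 = 0) -> (forall n, D' n 0 = 0) ->
  (forall n, D n vac = D' n vac) ->
  vac_local k D c -> vac_local k D' c -> forall n, D n c = D' n c.
Proof.
move=> D0 D'0 DD' [N DN] [N' D'N'] n.
pose F (p : int * int) := D p.1 (Y c p.2 vac) - D' p.1 (Y c p.2 vac) : V.
have FE : F = (-1) *: vac_bracket k D' c + vac_bracket k D c.
  apply/funext => p; rewrite !fctE /vac_bracket DD' scaleN1r opprB.
  by rewrite addrC addrA subrK.
have FN : iter (N + N') (diff d1 d2) F = 0.
  rewrite FE iter_diff_linear [in X in _ *: X]iterD D'N'.
  by rewrite addnC iterD DN !iter_diff0 scaler0 addr0.
have F0 p : 0 <= p.2 -> F p = 0.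
  by move=> p0; rewrite /F Y_create0 // D0 D'0 subr0.
apply/eqP; rewrite -subr_eq0; apply/eqP.
have := iter_diff_boundary (N + N') (n - (N + N')%N%:Z) F0 (lexx (-1)).
by rewrite FN subrK /F /= Y_create => <-.
Qed.

Lemma Y_vac_local pa pc a c : homog pa a -> homog pc c ->
  vac_local ((-1) ^+ (pa && pc)) (Y a) c.
Proof.
move=> ha hc; have [N LN] := Y_local ha hc; exists N.
by apply/funext => -[m n]; have := LN m n vac; rewrite iter_mul_zwE.
Qed.

Lemma T_mode_vac a (n : int) : T (Y a n vac) = - (n%:~R *: Y a (n - 1) vac).
Proof. by have := T_cov a n vac; rewrite T_vac mode0 subr0. Qed.

(** On the vacuum only the first sum of the normally ordered product survives.
    Translation covariance of both factors gives
      T (a_(-1-j) b_(n+j)|0>) = (j+1) w_(j+1) - (n+j) w_j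
    with w_j = a_(-1-j) b_(n-1+j)|0>. The part (j+1) w_(j+1) - j w_j telescopes
    to 0 and what remains is - n times the sum for n-1. *)
Lemma normal_mode_vac pa pb a b n :
  normal_mode pa pb a b n vac = Y (nprod a b) n vac.
Proof.
pose w n (j : nat) := Y a (- 1 - j%:Z) (Y b (n + j%:Z) vac) : V.
have wn m : ev_zero (w m).
  have [M HM] := Y_ev_zero b m vac; exists M => j /HM E.
  by rewrite /w E mode0.
have nE m : normal_mode pa pb a b m vac = \sum_(j \in [set: nat]) w m j.
  rewrite /normal_mode [X in _ *: X](@fsumE _ _ 0) => [|j _].
    by rewrite big_ord0 scaler0 addr0.
  by rewrite (@Y_create0 _ _ a) // mode0.
have wp m j : 0 <= m + j%:Z -> w m j = 0.
  by move=> mj; rewrite /w Y_create0 // mode0.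
move: n; apply: (@translation_unique (fun n => normal_mode pa pb a b n vac)
  (fun n => Y (nprod a b) n vac)) => n; last exact: T_mode_vac; last first.
  rewrite !nE (raddf_fsum T (wn n)).
  pose u (j : nat) := j%:R *: w (n - 1) j : V.
  have un : ev_zero u.
    by have [M HM] := wn (n - 1); exists M => j /HM E; rewrite /u E scaler0.
  have uS : ev_zero (fun j => u j.+1).
    by have [M HM] := un; exists M => j Mj; apply: HM; apply: leqW.
  have uD : ev_zero (fun j => -1 *: u j + u j.+1).
    have [M HM] := un; exists M => j Mj.
    by rewrite !HM ?scaler0 ?addr0 //; apply: leqW.
  have tel : \sum_(j \in [set: nat]) (-1 *: u j + u j.+1) = 0.
    rewrite fsum_linear // fsum_recl // /u scale0r add0r scaleN1r.
    by rewrite addNr.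
  rewrite -scaleNr -[RHS]addr0 -[X in _ = _ + X]tel -fsum_linear //.
  apply: eq_fsbigr => j _; rewrite /w /u.
  have := T_cov a (- 1 - j%:Z) (Y b (n + j%:Z) vac).
  move=> /eqP; rewrite subr_eq => /eqP E; rewrite [LHS]E {E}.
  have -> : w (n - 1) j.+1 = Y a (- 1 - j%:Z - 1) (Y b (n + j%:Z) vac).
    by congr (Y a _ (Y b _ vac)); lia.
  have k1 : - (- 1 - j%:Z)%:~R = j.+1%:R :> R[i].
    by rewrite -mulrNz pmulrn; congr (_ *~ _); lia.
  have k2 : - (n + j%:Z)%:~R = - n%:~R + -1 * j%:R :> R[i].
    by rewrite mulrzDr opprD mulN1r.
  rewrite T_mode_vac [n + j%:Z - 1]addrAC -!scaleNr modeZ k1 k2.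
  by rewrite [RHS]addrA scalerA -scalerDl [LHS]addrC.
move=> n1; have [n0|n0] := lerP 0 n.
  by rewrite nE Y_create0 // (@fsumE _ _ 0) ?big_ord0 // => j _; apply: wp; lia.
have -> : n = -1 by lia.
rewrite nE (@fsumE _ _ 1) => [|j j1]; last by apply: wp; lia.
have -> : \sum_(j < 1) w (-1) j = Y a (-1) (Y b (-1) vac) by rewrite big_ord1.
by rewrite !Y_create.
Qed.

Lemma normal_mode0 pa pb a b n : normal_mode pa pb a b n 0 = 0.
Proof.
rewrite /normal_mode !(@fsumE _ _ 0) ?big_ord0 ?scaler0 ?addr0 // => j _;
by rewrite !mode0.
Qed.

(** * The fields of a_(-1)b and of Ta *)

Lemma Y_nprod pa pb pc a b c n : homog pa a -> homog pb b -> homog pc c ->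
  Y (nprod a b) n c = normal_mode pa pb a b n c.
Proof.
move=> ha hb hc; apply/esym.
move: n; apply: (@vac_local_unique ((-1) ^+ ((pa (+) pb) && pc))
  (normal_mode pa pb a b) (Y (nprod a b))).
- exact: normal_mode0.
- by move=> m; exact: mode0.
- by move=> m; exact: normal_mode_vac.
- have [N LN] := normal_mode_local ha hb hc; exists N.
  by apply/funext => -[p q]; have := LN p q vac; rewrite iter_mul_zwE.
- by apply: Y_vac_local => //; exact: Y_parity.
Qed.

(** The derivative in z of a distribution killed by (z-w)^N is killed by
    (z-w)^(N+1), because (z-w) dF/dz = d((z-w)F)/dz - F. *)
Lemma iter_diff_derivative N (F : int * int -> V) :
  iter N (diff d1 d2) F = 0 ->
  iter N.+1 (diff d1 d2) (fun p => - (p.1%:~R *: F (p - d1))) = 0.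
Proof.
elim: N F => [|N IH] F FN.
  by apply/funext => p; rewrite [F]FN /= /diff !scaler0 oppr0 subrr.
rewrite iterSr.
have -> : diff d1 d2 (fun p => - (p.1%:~R *: F (p - d1))) =
    -1 *: F + (fun p => - (p.1%:~R *: diff d1 d2 F (p - d1))).
  apply/funext => p; rewrite !fctE /diff.
  rewrite addrK subrK [p - d1 + d2]addrAC /= addr0.
  rewrite rmorphD /= scalerDl scale1r scalerBr scaleN1r !opprD !opprK.
  by rewrite addrA [- F p + _]addrC.
by rewrite iter_diff_linear FN scaler0 add0r IH // -iterSr.
Qed.

(** Y(Ta,z) = dY(a,z)/dz by uniqueness: the right-hand side is local by
    [iter_diff_derivative], and on the vacuum it is T Y(a,z)|0>. *)
Lemma Y_T_homog pa pc a c n : homog pa a -> homog pc c ->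
  Y (T a) n c = - (n%:~R *: Y a (n - 1) c).
Proof.
move=> ha hc; have hTa : homog pa (T a) by exact: (T_even ha).
move: n; apply: (@vac_local_unique ((-1) ^+ (pa && pc)) (Y (T a))
  (fun n v => - (n%:~R *: Y a (n - 1) v))).
- by move=> n; exact: mode0.
- by move=> n; rewrite mode0 scaler0 oppr0.
- move=> n; rewrite -T_mode_vac; move: n.
  apply: (@translation_unique (fun n => Y (T a) n vac)
    (fun n => T (Y a n vac))) => n.
  + rewrite le_eqVlt => /orP[/eqP <-|n1]; first by rewrite !Y_create.
    have n0 : 0 <= n by lia.
    by rewrite !Y_create0 // linear0.
  + exact: T_mode_vac.
  + by rewrite T_mode_vac linearN linearZ /=.
- exact: Y_vac_local.
- have [N LN] := Y_vac_local ha hc; exists N.+1.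
  rewrite -(iter_diff_derivative LN); congr iter; apply/funext => p.
  rewrite /vac_bracket /= subr0 scalerBr opprB.
  rewrite -!scaleNr modeZ !scalerA [LHS]addrC.
  by congr (_ *: _ + _); rewrite mulrNN mulrC.
Qed.

Lemma Y_iterT pa pc a c k : homog pa a -> homog pc c ->
  Y (iter k T a) (-1) c = k`!%:R *: Y a (- 1 - k%:Z) c.
Proof.
move=> ha hc; elim: k a ha => [|k IH] a ha.
  by rewrite /= fact0 scale1r subr0.
rewrite iterSr IH; last exact: (T_even ha).
rewrite (Y_T_homog _ ha hc) -scaleNr -rmorphN /= scalerA factS natrM mulrC.
by congr (_ * _ *: Y a _ c); [rewrite pmulrn; congr (_ *~ _)|]; lia.
Qed.

End VertexAlgebra.

Unset Implicit Arguments.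

Theorem proposition4p4p4 (R : realType) (V : vertex_algebra R)
    (pa pb pc : bool) (a b c : V)
    (ha : homog pa a) (hb : homog pb b) (hc : homog pc c) :
  nprod (nprod a b) c - nprod a (nprod b c) =
    \sum_(j \in [set: nat]) Y a (- j%:Z - 2) (Y b j%:Z c)
    + (-1) ^+ (pa && pb) *:
        \sum_(j \in [set: nat]) Y b (- j%:Z - 2) (Y a j%:Z c)
  /\
  \sum_(j \in [set: nat]) Y a (- j%:Z - 2) (Y b j%:Z c)
    + (-1) ^+ (pa && pb) *:
        \sum_(j \in [set: nat]) Y b (- j%:Z - 2) (Y a j%:Z c) =
    nprod_int a (lbracket b c)
    + (-1) ^+ (pa && pb) *: nprod_int b (lbracket a c).
Proof.
have mode_int x y px py : homog px x -> homog py y ->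
    \sum_(j \in [set: nat]) Y x (- j%:Z - 2) (Y y j%:Z c) =
    nprod_int x (lbracket y c).
  move=> hx hy; rewrite nprod_int_lbracketE; apply: eq_fsbigr => j _.
  rewrite /nprod Y_scale (Y_iterT _ hx (Y_parity _ hy hc)) scalerA mulVf.
    by rewrite scale1r; congr (Y x _ _); lia.
  by rewrite pnatr_eq0 -lt0n fact_gt0.
split; last by rewrite (mode_int a b pa pb) // (mode_int b a pb pa).
have ab0 : ev_zero (fun j : nat => Y a (- 1 - j%:Z) (Y b (-1 + j%:Z) c)).
  by have [M HM] := Y_ev_zero b (-1) c; exists M => j /HM ->; rewrite mode0.
apply/eqP; rewrite subr_eq; apply/eqP.
rewrite {1}/nprod (Y_nprod _ ha hb hc) /normal_mode fsum_recl //.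
rewrite [RHS]addrC [RHS]addrA; congr (_ + _ + _ *: _).
  apply: eq_fsbigr => j _; congr (Y a _ (Y b _ c)); lia.
by apply: eq_fsbigr => j _; congr (Y b _ _); lia.
Qed.
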